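(* Let $A\in\mathscr R$ be a fixed set and let $\mathbf X^{(1)},\mathbf X^{(2)}$ be independent random vectors in $[0,\infty)^d$ with distributions $F_1,F_2$ respectively. (i) If $F_1,F_2\in\mathcal D_A$, then $F_1*F_2(xA)\asymp F_1(xA)+F_2(xA)$ as $x\to\infty$, and $F_1*F_2\in\mathcal D_A$. (ii) If $F_1,F_2\in(\mathcal D\cap\mathcal L)_A$, then $F_1*F_2(xA)\sim F_1(xA)+F_2(xA)$ as $x\to\infty$, and $F_1*F_2\in(\mathcal D\cap\mathcal L)_A$. (iii) If $F_1,F_2\in\mathcal C_A$, then $F_1*F_2(xA)\sim F_1(xA)+F_2(xA)$ as $x\to\infty$, and $F_1*F_2\in\mathcal C_A$.
   Context: Fix an integer $d\ge 1$. $\mathscr R$ is the family of nonempty sets $A\subsetneq\mathbb R^d$ that are open, increasing (if $\mathbf x\in A$ and $\mathbf a\in[0,\infty)^d$ then $\mathbf x+\mathbf a\in A$), have convex complement $A^c$, and satisfy $\mathbf 0\notin\overline A$ (closure). For a random vector $\mathbf X$ in $[0,\infty)^d$ with distribution $F$ write $F(xA):=\mathbf P[\mathbf X\in xA]$, put $Y_A:=\sup\{u>0:\mathbf X\in uA\}$ (with $\sup\emptyset=0$), and let $F_A$ be the distribution of $Y_A$; its tail is $\overline F_A(x)=\mathbf P[Y_A>x]=\mathbf P[\mathbf X\in xA]$ for $x>0$. For a distribution $V$ on $[0,\infty)$ write $\overline V=1-V$ and assume $\overline V(x)>0$ for all $x\ge0$. $V\in\mathcal C$ if $\lim_{b\uparrow1}\limsup_{x\to\infty}\overline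 V(bx)/\overline V(x)=1$. $V\in\mathcal D$ if $\limsup_{x\to\infty}\overline V(bx)/\overline V(x)<\infty$ for every (equivalently, some) $b\in(0,1)$. $V\in\mathcal L$ if $\lim_{x\to\infty}\overline V(x-y)/\overline V(x)=1$ for every (equivalently, some) $y>0$. For $\mathcal B\in\{\mathcal C,\mathcal D,\mathcal D\cap\mathcal L\}$, $F\in\mathcal B_A$ means $F_A\in\mathcal B$. $F_1*F_2$ is the distribution of $\mathbf X^{(1)}+\mathbf X^{(2)}$ (independent summands), so $F_1*F_2(xA)=\mathbf P[\mathbf X^{(1)}+\mathbf X^{(2)}\in xA]$, and $F_1*F_2\in\mathcal B_A$ means that the distribution of $\sup\{u>0:\mathbf X^{(1)}+\mathbf X^{(2)}\in uA\}$ is in $\mathcal B$. $f\sim g$ means $f/g\to1$; $f\asymp g$ means $f=O(g)$ and $g=O(f)$, as $x\to\infty$. *)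

(* Defs.v *)
From HB Require Import structures.
From mathcomp Require Import all_boot all_order all_algebra.
From mathcomp Require Import all_classical all_reals all_analysis.
From mathcomp Require Import measurable_realfun.

Set Implicit Arguments.
Unset Strict Implicit.
Unset Printing Implicit Defensive.

Import Order.TTheory GRing.Theory Num.Theory.
Import numFieldNormedType.Exports.

Local Open Scope classical_set_scope.
Local Open Scope ring_scope.

(* [R^d] with its Borel sigma-algebra; convertible to ['rV[R]_d]. *)
Definition borel_rV (R : realType) (d : nat) : Type :=
  g_sigma_algebraType (@open 'rV[R]_d).

Lemma measurable_coord (R : realType) (d : nat) (i : 'I_d) :
  measurable_fun [set: borel_rV R d]
    (fun x : borel_rV R d => (x : 'rV[R]_d) ord0 i).
Proof.
apply: (measurability _ (RGenOpens.measurableE R)) => _ [_ [a [b ->]] <-].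
rewrite setTI; apply: sub_sigma_algebra.
have /continuousP : continuous (fun x : 'rV[R]_d => x ord0 i).
  exact: coord_continuous.
by apply; exact: interval_open.
Qed.

Lemma measurable_fun_coord (disp : measure_display)
    (Omega : measurableType disp) (R : realType) (d : nat)
    (f : Omega -> borel_rV R d) :
  (forall i, measurable_fun [set: Omega]
    (fun w => (f w : 'rV[R]_d) ord0 i : R)) ->
  measurable_fun [set: Omega] f.
Proof.
move=> mf; apply: (@measurability _ _ _ (borel_rV R d) _ _ (@open 'rV[R]_d)) => //.
move=> _ [U oU <-]; rewrite setTI.
pose box (p : 'rV[rat]_d * 'rV[rat]_d) : set Omega := \bigcap_(i in [set: 'I_d])
  (fun w => (f w : 'rV[R]_d) ord0 i) @^-1`
    `](ratr (p.1 ord0 i)), (ratr (p.2 ord0 i))[.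
pose F p := if `[< box p `<=` f @^-1` U >] then box p else set0.
have -> : f @^-1` U = \bigcup_p F p.
  apply/seteqP; split => [w Uw|w [p _]]; last first.
    by rewrite /F; case: ifPn => // /asboolP; apply.
  have /nbhs_ballP[e /= e0 eU] : nbhs (f w : 'rV[R]_d) U.
    by apply: open_nbhs_nbhs; split.
  have aP i : {q : rat | ratr q \in `](f w : 'rV[R]_d) ord0 i - e,
                                      (f w : 'rV[R]_d) ord0 i[}.
    by apply/cid; apply: rat_in_itvoo; rewrite gtrBl.
  have bP i : {q : rat | ratr q \in `](f w : 'rV[R]_d) ord0 i,
                                      (f w : 'rV[R]_d) ord0 i + e[}.
    by apply/cid; apply: rat_in_itvoo; rewrite ltrDl.
  pose p := (\row_i sval (aP i), \row_i sval (bP i)).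
  exists p => //; rewrite /F.
  have -> : `[< box p `<=` f @^-1` U >].
    apply/asboolP => v vp; apply: eU; split => // i j; rewrite (ord1 i).
    have := vp j I; rewrite /= !mxE /= !in_itv/= => /andP[av vb].
    have := svalP (aP j); rewrite in_itv/= => /andP[ea _].
    have := svalP (bP j); rewrite in_itv/= => /andP[_ be].
    rewrite /ball/= ltr_distlC; apply/andP; split; first exact: lt_trans ea av.
    exact: lt_trans vb be.
  move=> i _; rewrite /= !mxE in_itv/=.
  have := svalP (aP i); rewrite in_itv/= => /andP[_ ->].
  by have := svalP (bP i); rewrite in_itv/= => /andP[-> _].
apply: countable_bigcupT_measurable => [|p]; first exact: countableP.
rewrite /F; case: ifPn => _ //.
apply: fin_bigcap_measurable => // i _.
by rewrite -[X in measurable X]setTI; exact: mf.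
Qed.

Section sum_of_random_vectors.
Context {disp : measure_display} {Omega : measurableType disp}.
Context {R : realType} {d : nat} {P : probability Omega R}.
Variables X Y : {RV P >-> borel_rV R d}.

Definition sum_rv (w : Omega) : borel_rV R d :=
  (X w : 'rV[R]_d) + (Y w : 'rV[R]_d).

Lemma measurable_sum_rv : measurable_fun [set: Omega] sum_rv.
Proof.
apply: measurable_fun_coord => i.
rewrite (_ : (fun w => _) =
    (fun w => (X w : 'rV[R]_d) ord0 i) \+ (fun w => (Y w : 'rV[R]_d) ord0 i)).
  by apply: measurable_funD; apply: (measurableT_comp (measurable_coord i));
    exact: measurable_funPT.
by apply/funext => w; rewrite /sum_rv !mxE.
Qed.

HB.instance Definition _ :=
  isMeasurableFun.Build _ _ _ _ sum_rv measurable_sum_rv.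

End sum_of_random_vectors.

Definition independent_rv {disp disp1 disp2 : measure_display}
    {Omega : measurableType disp} {T1 : measurableType disp1}
    {T2 : measurableType disp2} {R : realType} (P : probability Omega R)
    (X : {RV P >-> T1}) (Y : {RV P >-> T2}) : Prop :=
  forall (B : set T1) (C : set T2), measurable B -> measurable C ->
    P (X @^-1` B `&` Y @^-1` C) = (P (X @^-1` B) * P (Y @^-1` C))%E.

Definition orthant (R : realType) (d : nat) : set 'rV[R]_d :=
  [set x | forall i, 0 <= x ord0 i].

Definition increasing_set {R : realType} {d : nat} (A : set 'rV[R]_d) : Prop :=
  forall x a, A x -> orthant a -> A (x + a).

(* The family of sets written [\mathscr R]. *)
Definition ruin_set {R : realType} {d : nat} (A : set 'rV[R]_d) : Prop :=
  [/\ A !=set0 /\ A <> setT,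
      open A,
      increasing_set A,
      convex_set (~` A : set (convex_lmodType 'rV[R]_d)) &
      ~ closure A 0].

Definition dilate {R : realType} {d : nat} (u : R) (A : set 'rV[R]_d) :
    set 'rV[R]_d :=
  (fun a => u *: a) @` A.

(* [Y_A = scale_sup A X]; [sup] of the empty set is [0] in the library. *)
Definition scale_sup {R : realType} {d : nat} (A : set 'rV[R]_d) (x : 'rV[R]_d) : R :=
  sup [set u | 0 < u /\ dilate u A x].

(* [F_A], the image of [F] under [scale_sup A]. *)
Definition scale_law {R : realType} {d : nat} (A : set 'rV[R]_d)
    (F : set (borel_rV R d) -> \bar R) : set R -> \bar R :=
  pushforward F (scale_sup A : borel_rV R d -> R).

Definition tail {R : realType} (V : set R -> \bar R) (x : R) : R :=
  fine (V `]x, +oo[%classic).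

Definition positive_tail {R : realType} (V : set R -> \bar R) : Prop :=
  forall x, 0 <= x -> 0 < tail V x.

Definition limsup_tail_ratio {R : realType} (V : set R -> \bar R) (b : R) :
    \bar R :=
  limf_esup (fun x : R => (tail V (b * x) / tail V x)%:E) (pinfty_nbhs R).

Definition class_C {R : realType} (V : set R -> \bar R) : Prop :=
  positive_tail V /\ limsup_tail_ratio V b @[b --> 1^'-] --> 1%E.

Definition class_D {R : realType} (V : set R -> \bar R) : Prop :=
  positive_tail V /\
  forall b, 0 < b < 1 -> (limsup_tail_ratio V b < +oo)%E.

Definition class_L {R : realType} (V : set R -> \bar R) : Prop :=
  positive_tail V /\
  forall y, 0 < y -> tail V (x - y) / tail V x @[x --> +oo] --> (1 : R).

Definition class_DL {R : realType} (V : set R -> \bar R) : Prop :=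
  class_D V /\ class_L V.

Definition asymp_equiv {R : realType} (f g : R -> R) : Prop :=
  f x / g x @[x --> +oo] --> (1 : R).

(* [pinfty_nbhs R] packaged as a filter, as the Landau notations require. *)
Definition at_infty {R : realType} : filter_on R :=
  FilterType (pinfty_nbhs R) (@filter_filter _ _ proper_pinfty_nbhs).

Definition same_order {R : realType} (f g : R -> R) : Prop :=
  (f : R -> R^o) =O_at_infty (g : R -> R^o) /\
  (g : R -> R^o) =O_at_infty (f : R -> R^o).

(* Main.v *)
Require Import Defs.
From HB Require Import structures.
From mathcomp Require Import all_boot all_order all_algebra.
From mathcomp Require Import all_classical all_reals all_analysis.
From mathcomp Require Import measurable_realfun ring lra.

Set Implicit Arguments.
Unset Strict Implicit.
Unset Printing Implicit Defensive.

Import Order.TTheory GRing.Theory Num.Theory.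
Import numFieldNormedType.Exports.

Local Open Scope classical_set_scope.
Local Open Scope ring_scope.

(** On the nonnegative orthant the functional [Y = scale_sup A] turns the
    multivariate statement into a one-dimensional one.  Because [A] is open and
    increasing, [Y x > t] means exactly [x \in t A] for [t > 0]
    ([scale_sup_gtP]); because [A] is increasing, adding a nonnegative vector
    cannot decrease [Y] ([scale_sup_le_add]); and because the complement of [A]
    is convex, [Y] is subadditive ([scale_sup_subadditive]).  Hence, with
    [Y1 = Y X1], [Y2 = Y X2] and [Z = Y (X1 + X2)],
      [max Y1 Y2 <= Z <= Y1 + Y2],
    where [Y1] and [Y2] are independent and nonnegative.

    Let [f], [g], [h] be the tails of [Y1], [Y2], [Z].  The lower bound on [Z]
    and inclusion-exclusion give [h >= f + g - f g], and [f g] is negligible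
    since [f] vanishes at infinity ([sum_tail_ge]).  For the upper bound, if
    [Z > x] then one of [Y1], [Y2] exceeds [x / 2]; under dominated variation
    this already gives the right order ([sum_tail_order]).  More precisely,
    for a fixed level [k], either one of them exceeds [x - k], or both exceed
    [k] and one exceeds [x / 2]; the second event has probability at most
    [f k g (x / 2) + g k f (x / 2)], which by dominated variation is at most a
    small multiple of [f x + g x] once [k] is large, and a long tail does not
    notice the shift by [k] ([sum_tail_equiv]).  Consistent variation implies
    both dominated variation and long-tailedness, so the asymptotic equivalence
    in the last case follows from that in the second one.

    Finally, each of the classes is described by inequalities
    [V (s x) <= c * V x], for large [x], where [s] is a dilation or a
    translation.  Such an inequality passes to sums, and from [f + g] to [h] at
    the price of a factor that is as close to [1] as the comparison between the
    two functions ([ratio_transfer]); this yields the closure statements. *)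

(** * Eventual inequalities between a tail and its dilates and translates *)

Section eventual_inequalities.
Context {R : realType}.
Implicit Types (f g s : R -> R) (b c e m M : R).

(** Rewriting a limit superior or a limit of [f (s x) / f x] as an inequality
    between products makes the conditions additive in [f]. *)
Definition dominated f := forall b, 0 < b < 1 ->
  exists2 c, 0 <= c & \forall x \near +oo, f (b * x) <= c * f x.

Definition long f := forall y, 0 < y -> forall e, 0 < e ->
  \forall x \near +oo, f (x - y) <= (1 + e) * f x.

Definition consistent f := forall e, 0 < e -> exists2 b, 0 < b < 1 &
  \forall x \near +oo, f (b * x) <= (1 + e) * f x.

(** [f ~ g] without division, in the form in which it is combined with the
    previous conditions. *)
Definition tail_equiv f g := forall e, 0 < e ->
  \forall x \near +oo, (1 - e) * g x <= f x <= (1 + e) * g x.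

Lemma cvgy_scale b : 0 < b -> b * x @[x --> +oo] --> pinfty_nbhs R.
Proof.
move=> b0; apply/cvgryPgt => a; near=> x.
by rewrite -ltr_pdivrMl//; near: x; apply: nbhs_pinfty_gt; rewrite num_real.
Unshelve. all: by end_near. Qed.

Lemma cvgy_shift y : x - y @[x --> +oo] --> pinfty_nbhs R.
Proof.
apply/cvgryPgt => a; near=> x.
by rewrite ltrBrDr; near: x; apply: nbhs_pinfty_gt; rewrite num_real.
Unshelve. all: by end_near. Qed.

(** The comparison is used twice: at [s x], to pass from [f] to [g], and at [x],
    to come back; whence the factor [M / m].  The argument is the same for
    dilations and translations. *)
Lemma ratio_transfer s f g m M c : s x @[x --> +oo] --> pinfty_nbhs R ->
  0 < m -> 0 <= M -> 0 <= c ->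
  (\forall x \near +oo, m * g x <= f x <= M * g x) ->
  (\forall x \near +oo, g (s x) <= c * g x) ->
  \forall x \near +oo, f (s x) <= M * c / m * f x.
Proof.
move=> sy m0 M0 c0 fg gs.
have fgs := sy _ fg; near=> x.
have /andP[_ fsM] : m * g (s x) <= f (s x) <= M * g (s x) by near: x.
have /andP[mf _] : m * g x <= f x <= M * g x by near: x.
have gsc : g (s x) <= c * g x by near: x.
apply: (le_trans fsM); apply: (le_trans (ler_wpM2l M0 gsc)).
rewrite mulrA -[leRHS]mulrA ler_wpM2l ?mulr_ge0//.
by rewrite -ler_pdivrMl ?invr_gt0// invrK.
Unshelve. all: by end_near. Qed.

Lemma dominated_transfer f g m M : 0 < m -> 0 <= M ->
  (\forall x \near +oo, m * g x <= f x <= M * g x) ->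
  dominated g -> dominated f.
Proof.
move=> m0 M0 fg gD b b01; have [c c0 gb] := gD b b01.
exists (M * c / m); first by rewrite divr_ge0// ?mulr_ge0// ltW.
by apply: ratio_transfer gb => //; apply: cvgy_scale; case/andP: b01.
Qed.

(** The accuracy [e'] required of [g] is chosen before the transformation [s],
    because for [consistent] the dilation itself depends on that accuracy. *)
Lemma tail_equiv_ratio f g e : (forall x, 0 <= f x) -> tail_equiv f g -> 0 < e ->
  exists2 e', 0 < e' & forall s, s x @[x --> +oo] --> pinfty_nbhs R ->
  (\forall x \near +oo, g (s x) <= (1 + e') * g x) ->
  \forall x \near +oo, f (s x) <= (1 + e) * f x.
Proof.
move=> f0 fg e0.
(* for q <= 1/2, (1 + q)^2 / (1 - q) is at most 1 + 8 q *)
pose q := Num.min (2^-1 : R) (e / 8).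
have q0 : 0 < q by rewrite lt_min; apply/andP; split; lra.
have q2 : q <= 2^-1 by rewrite ge_min lexx.
have qe : q <= e / 8 by rewrite ge_min lexx orbT.
have [q1 q1' q1''] : [/\ 0 < 1 - q, 0 <= 1 + q & 0 <= 1 + q] by split; lra.
exists q => // s sy gs.
apply: filterS (ratio_transfer sy q1 q1' q1'' (fg _ q0) gs) => x.
move=> /le_trans; apply; apply: ler_wpM2r => //.
rewrite ler_pdivrMr//; nra.
Qed.

Lemma tail_equiv_long f g : (forall x, 0 <= f x) -> tail_equiv f g -> long g -> long f.
Proof.
move=> f0 fg gl y y0 e e0; have [e' e'0] := tail_equiv_ratio f0 fg e0.
by apply; [exact: cvgy_shift|exact: gl].
Qed.

Lemma tail_equiv_consistent f g :
  (forall x, 0 <= f x) -> tail_equiv f g -> consistent g -> consistent f.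
Proof.
move=> f0 fg gc e e0; have [e' e'0 H] := tail_equiv_ratio f0 fg e0.
have [b b01 gb] := gc _ e'0; exists b => //.
by apply: H gb; apply: cvgy_scale; case/andP: b01.
Qed.

Lemma tail_equiv_dominated f g :
  (forall x, 0 <= f x) -> tail_equiv f g -> dominated g -> dominated f.
Proof.
move=> f0 fg; have e0 : (0 : R) < 2^-1 by lra.
by apply: dominated_transfer (fg _ e0); lra.
Qed.

Lemma dominated_half f : (forall x, 0 <= f x) -> dominated f ->
  exists2 c, 0 < c & \forall x \near +oo, f (x / 2) <= c * f x.
Proof.
move=> f0 /(_ 2^-1)[|c c0 fc]; first by apply/andP; split; lra.
exists (c + 1); first lra.
by apply: filterS fc => x; rewrite mulrC; have := f0 x; nra.
Qed.

Section sum.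
Variables f g : R -> R.
Hypotheses (f0 : forall x, 0 <= f x) (g0 : forall x, 0 <= g x).

Lemma dominatedD : dominated f -> dominated g -> dominated (f \+ g).
Proof.
move=> fD gD b b01; have [c c0 fc] := fD b b01; have [c' c'0 gc] := gD b b01.
exists (c + c'); first exact: addr_ge0.
near=> x; rewrite /=.
have fx : f (b * x) <= c * f x by near: x.
have gx : g (b * x) <= c' * g x by near: x.
by have := f0 x; have := g0 x; nra.
Unshelve. all: by end_near. Qed.

Lemma longD : long f -> long g -> long (f \+ g).
Proof.
move=> fL gL y y0 e e0; near=> x; rewrite /= mulrDr.
by apply: lerD; near: x; [exact: fL|exact: gL].
Unshelve. all: by end_near. Qed.

Lemma consistentD : {homo f : x y /~ x <= y} -> {homo g : x y /~ x <= y} ->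
  consistent f -> consistent g -> consistent (f \+ g).
Proof.
move=> fni gni fC gC e e0.
have [b /andP[b0 b1] fb] := fC e e0; have [b' /andP[b'0 b'1] gb] := gC e e0.
exists (Num.max b b').
  by rewrite lt_max b0 gt_max b1 b'1.
near=> x; rewrite /= mulrDr.
have x0 : 0 <= x by near: x; apply: nbhs_pinfty_ge; rewrite num_real.
apply: lerD.
- apply: (@le_trans _ _ (f (b * x))); last by near: x.
  by apply: fni; rewrite ler_wpM2r// le_max lexx.
- apply: (@le_trans _ _ (g (b' * x))); last by near: x.
  by apply: gni; rewrite ler_wpM2r// le_max lexx orbT.
Unshelve. all: by end_near. Qed.

End sum.

(** One bound [f (b0 x) <= 2 f x] can be iterated along the powers of [b0],
    and monotonicity interpolates between them. *)
Lemma consistent_dominated f :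
  (forall x, 0 <= f x) -> {homo f : x y /~ x <= y} ->
  consistent f -> dominated f.
Proof.
move=> f0 fni /(_ 1 ltr01)[b0 /andP[b00 b01] fb].
have iter n : exists2 c, 0 <= c &
    \forall x \near +oo, f (b0 ^+ n * x) <= c * f x.
  elim: n => [|n [c c0 IH]].
    by exists 1 => //; apply: nearW => x; rewrite expr0 !mul1r.
  exists ((1 + 1) * c); first by rewrite mulr_ge0.
  have cv := cvgy_scale (exprn_gt0 n b00).
  have H := cv _ fb; near=> x.
  rewrite exprS -mulrA.
  have : f (b0 * (b0 ^+ n * x)) <= (1 + 1) * f (b0 ^+ n * x) by near: x.
  move=> /le_trans; apply; rewrite -mulrA ler_wpM2l//.
  by near: x.
move=> b /andP[b_gt0 b_lt1].
have [n nb] : exists n, b0 ^+ n <= b.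
  have := @cvg_expr R b0; rewrite ger0_norm ?ltW// => /(_ b01).
  move=> /cvgr0Pnorm_le /(_ b b_gt0)[n _ /(_ n (leqnn n))] /=.
  by rewrite ger0_norm ?exprn_ge0 ?(ltW b00)// => ?; exists n.
have [c c0 H] := iter n; exists c => //; near=> x.
apply: (@le_trans _ _ (f (b0 ^+ n * x))); last by near: x.
by apply: fni; rewrite ler_wpM2r//; near: x; apply: nbhs_pinfty_ge; rewrite num_real.
Unshelve. all: by end_near. Qed.

(** For large [x] the translate [x - y] lies above the dilate [b x]. *)
Lemma consistent_long f : (forall x, 0 <= f x) -> {homo f : x y /~ x <= y} ->
  consistent f -> long f.
Proof.
move=> f0 fni fC y y0 e e0; have [b /andP[b0 b1] fb] := fC e e0.
near=> x; apply: (@le_trans _ _ (f (b * x))); last by near: x.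
have b1_gt0 : 0 < 1 - b by rewrite subr_gt0.
apply: fni; rewrite lerBrDr -lerBrDl -{1}[x]mul1r -mulrBl mulrC.
rewrite -ler_pdivrMr; last by [].

by near: x; apply: nbhs_pinfty_ge; rewrite num_real.
Unshelve. all: by end_near. Qed.

(** Three functions related as are the tails of two independent nonnegative
    variables [Y1], [Y2] and of some [Z] between [max Y1 Y2] and
    [Y1 + Y2]. *)
Section sum_tail.
Variables f g h : R -> R.
Hypotheses (f0 : forall x, 0 <= f x) (g0 : forall x, 0 <= g x).
Hypotheses (fy : f x @[x --> +oo] --> (0 : R)) (gy : g x @[x --> +oo] --> (0 : R)).
Hypothesis h_ge : forall x, 0 < x -> f x + g x - f x * g x <= h x.
Hypothesis h_half : forall x, h x <= f (x / 2) + g (x / 2).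
Hypothesis h_le : forall k x, 0 < k -> 0 < x ->
  h x <= f (x - k) + g (x - k) + f k * g (x / 2) + g k * f (x / 2).

(** The product [f x * g x] is at most [e * g x] as soon as [f x <= e]. *)
Lemma sum_tail_ge e : 0 < e ->
  \forall x \near +oo, (1 - e) * (f x + g x) <= h x.
Proof.
move=> e0; near=> x.
have x0 : 0 < x by near: x; apply: nbhs_pinfty_gt; rewrite num_real.
apply: le_trans (h_ge x0).
have fe : f x <= e by apply: ltW; near: x; exact: cvgr_lt fy _ e0.
by have := f0 x; have := g0 x; nra.
Unshelve. all: by end_near. Qed.

Lemma sum_tail_order : dominated f -> dominated g ->
  exists2 M, 0 < M & \forall x \near +oo,
    2^-1 * (f x + g x) <= h x <= M * (f x + g x).
Proof.
move=> /(dominated_half f0)[c c0 fc] /(dominated_half g0)[c' c'0 gc].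
exists (c + c'); first exact: addr_gt0.
near=> x; apply/andP; split.
  rewrite (_ : 2^-1 = 1 - 2^-1); last lra.
  by near: x; apply: sum_tail_ge; lra.
apply: (le_trans (h_half x)).
have fx : f (x / 2) <= c * f x by near: x.
have gx : g (x / 2) <= c' * g x by near: x.
by have := f0 x; have := g0 x; nra.
Unshelve. all: by end_near. Qed.

(** The constants [c], [c'] of dominated variation at the factor [1/2] are fixed
    first; then [k] is taken so large that [c' * f k] and [c * g k] are below
    [e / 2], which leaves another [e / 2] for the translation by [k]. *)
Lemma sum_tail_equiv : dominated f -> dominated g -> long f -> long g ->
  tail_equiv h (f \+ g).
Proof.
move=> /(dominated_half f0)[c c0 fc] /(dominated_half g0)[c' c'0 gc] fL gL e e0.
have e2 : 0 < e / 2 by lra.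
have [k [k0 fk gk]] : exists k, [/\ 0 < k, f k <= e / 2 / c' & g k <= e / 2 / c].
  near (pinfty_nbhs R) => k; exists k; split; near: k.
  - by apply: nbhs_pinfty_gt; rewrite num_real.
  - by apply: filterS (cvgr_lt _ fy _ (divr_gt0 e2 c'0)) => x /ltW.
  - by apply: filterS (cvgr_lt _ gy _ (divr_gt0 e2 c0)) => x /ltW.
near=> x; rewrite /=; apply/andP; split; first by near: x; exact: sum_tail_ge.
have x0 : 0 < x by near: x; apply: nbhs_pinfty_gt; rewrite num_real.
apply: (le_trans (h_le k0 x0)).
have fx : f (x - k) <= (1 + e / 2) * f x by near: x; exact: fL.
have gx : g (x - k) <= (1 + e / 2) * g x by near: x; exact: gL.
have fgx : f k * g (x / 2) <= e / 2 * g x.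
  have : g (x / 2) <= c' * g x by near: x.
  move=> /(ler_pM (f0 _) (g0 _) fk) /le_trans; apply.
  by rewrite mulrA divfK// gt_eqF.
have gfx : g k * f (x / 2) <= e / 2 * f x.
  have : f (x / 2) <= c * f x by near: x.
  move=> /(ler_pM (g0 _) (f0 _) gk) /le_trans; apply.
  by rewrite mulrA divfK// gt_eqF.
lra.
Unshelve. all: by end_near. Qed.

End sum_tail.

End eventual_inequalities.

(** * The classes of tails as eventual inequalities *)

Section class_characterizations.
Context {R : realType}.

Lemma limf_esup_lt_near (f : R -> \bar R) (F : set_system R) c : Filter F ->
  (limf_esup f F < c)%E -> \forall x \near F, (f x < c)%E.
Proof.
move=> FF; rewrite limf_esupE => /ereal_inf_lt[_ [B FB <-] Bc].
apply: filterS FB => x Bx; apply: le_lt_trans Bc.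
by apply: ereal_sup_ubound; exists x.
Qed.

Lemma limf_esup_le_near (f : R -> \bar R) (F : set_system R) c :
  (\forall x \near F, (f x <= c)%E) -> (limf_esup f F <= c)%E.
Proof.
move=> Fc; rewrite limf_esupE; apply: ge_ereal_inf.
exists (ereal_sup (f @` [set x | (f x <= c)%E])); first by exists [set x | (f x <= c)%E].
by apply: ge_ereal_sup => _ [x ? <-].
Qed.

Lemma limf_esup_ge_near (f : R -> \bar R) (F : set_system R) c : ProperFilter F ->
  (\forall x \near F, (c <= f x)%E) -> (c <= limf_esup f F)%E.
Proof.
move=> FF Fc; rewrite limf_esupE; apply: le_ereal_inf_tmp => _ [B FB <-].
have [x [cx Bx]] := filter_ex (filterI Fc FB).
by apply: (le_trans cx); apply: ereal_sup_ubound; exists x.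
Qed.

Variable V : set R -> \bar R.
Hypothesis V_ni : {homo tail V : x y /~ x <= y}.

Let tail_gt0_near : positive_tail V -> \forall x \near +oo, 0 < x /\ 0 < tail V x.
Proof.
move=> V_gt0; near=> x.
have x0 : 0 < x by near: x; apply: nbhs_pinfty_gt; rewrite num_real.
by split=> //; exact/V_gt0/ltW.
Unshelve. all: by end_near. Qed.

Lemma class_DP : class_D V <-> positive_tail V /\ dominated (tail V).
Proof.
split=> [][V_gt0 VD]; have V_near := tail_gt0_near V_gt0; split=> // b b01.
  have [c c0 /limf_esup_lt_near H] :
      exists2 c, 0 <= c & (limsup_tail_ratio V b < c%:E)%E.
    case: (limsup_tail_ratio V b) (VD b b01) => [r _|//|_]; last by exists 0; rewrite ?ltNyr.
    exists (`|r| + 1); rewrite ?addr_ge0// lte_fin.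
    by rewrite (le_lt_trans (ler_norm _))// ltrDl.
  exists c => //; apply: filterS2 V_near H => x [_ Vx].
  by rewrite lte_fin ltr_pdivrMr// => /ltW.
have [c c0 Vb] := VD b b01.
apply: le_lt_trans (ltry c); apply: limf_esup_le_near.
apply: filterS2 V_near Vb => x [_ Vx].
by rewrite lee_fin ler_pdivrMr.
Qed.

Lemma class_LP : class_L V <-> positive_tail V /\ long (tail V).
Proof.
split=> [][V_gt0 VL]; have V_near := tail_gt0_near V_gt0; split=> // y y0.
  move=> e e0.
  have /cvgrPdist_le/(_ e e0) := VL y y0.
  apply: filterS2 V_near => x [_ Vx].
  rewrite ler_distlC => /andP[_]; rewrite ler_pdivrMr//; lra.
apply/cvgrPdist_le => e e0.
apply: filterS2 V_near (VL y y0 e e0) => x [_ Vx] Vxy.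
have Vxy' : tail V x <= tail V (x - y) by apply: V_ni; rewrite gerBl ltW.
by rewrite ler_distlC ler_pdivrMr// ler_pdivlMr//; apply/andP; split; nra.
Qed.

(** From right to left: consistency gives one dilation factor [b0], and every
    [b] in [(b0, 1)] inherits the bound by monotonicity, which also gives the
    lower bound [1] for the limit superior. *)
Lemma class_CP : class_C V <-> positive_tail V /\ consistent (tail V).
Proof.
split=> [][V_gt0 VC]; have V_near := tail_gt0_near V_gt0; split=> //.
  move=> e e0.
  have e1 : (1%:E < (1 + e)%:E :> \bar R)%E by rewrite lte_fin ltrDl.
  have VCe := VC _ (open_ereal_lt' e1).
  have [b [Vb b0 b1]] : exists b, [/\ (limsup_tail_ratio V b < (1 + e)%:E)%E,
      0 < b & b < 1].
    near (1 : R)^'- => b; exists b; split; near: b => //.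
    - exact: nbhs_left_gt.
    - exact: nbhs_left_lt.
  exists b; first by rewrite b0.
  apply: filterS2 V_near (limf_esup_lt_near _ Vb) => x [_ Vx].
  by rewrite lte_fin ltr_pdivrMr// => /ltW.
have Vge b : b <= 1 -> (1 <= limsup_tail_ratio V b)%E.
  move=> b1; apply: limf_esup_ge_near.
  apply: filterS V_near => x [x0 Vx]; rewrite lee_fin ler_pdivlMr// mul1r.
  by apply: V_ni; rewrite ger_pMl.
have Vle e : 0 < e -> \forall b \near 1^'-, (limsup_tail_ratio V b <= (1 + e)%:E)%E.
  move=> e0; have [b0 /andP[_ b01] Vb] := VC e e0; near=> b.
  apply: limf_esup_le_near; apply: filterS2 V_near Vb => x [x0 Vx] Vbx.
  rewrite lee_fin ler_pdivrMr//; apply: le_trans Vbx.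
  apply: V_ni; rewrite ler_wpM2r// ltW//; near: b; exact: nbhs_left_gt.
have b_le1 : \forall b \near (1 : R)^'-, b <= 1.
  by apply: filterS (@nbhs_left_lt _ _) => b /ltW.
have fin : \forall b \near 1^'-, limsup_tail_ratio V b \is a fin_num.
  near=> b; have b1 : b <= 1 by near: b.
  have V2 : (limsup_tail_ratio V b <= (1 + 1)%:E)%E by near: b; exact: Vle.
  apply: fin_real; apply/andP; split.
    exact: lt_le_trans (ltNyr 1) (Vge _ b1).
  exact: le_lt_trans V2 (ltry _).
apply/fine_cvgP; split=> //; apply/cvgrPdist_le => e e0.
near=> b; have b1 : b <= 1 by near: b.
have Vf : limsup_tail_ratio V b \is a fin_num by near: b.
have V2 : (limsup_tail_ratio V b <= (1 + e)%:E)%E by near: b; exact: Vle.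
have := Vge _ b1; rewrite /= -(fineK Vf) in V2 *.
move: V2; rewrite !lee_fin => V2 V1; rewrite ler_distlC; apply/andP; split; lra.
Unshelve. all: by end_near. Qed.

End class_characterizations.

(** * Landau relations at infinity *)

Lemma tail_equiv_asymp_equiv (R : realType) (f g : R -> R) :
  (\forall x \near +oo, 0 < g x) -> tail_equiv f g -> asymp_equiv f g.
Proof.
move=> g0 fg; apply/cvgrPdist_le => e e0.
apply: filterS2 g0 (fg _ e0) => x gx /andP[lo hi].
by rewrite ler_distlC ler_pdivlMr// ler_pdivrMr// lo.
Qed.

Lemma bounds_same_order (R : realType) (f g : R -> R) m M : 0 < m -> 0 < M ->
  (\forall x \near +oo, 0 <= g x) ->
  (\forall x \near +oo, m * g x <= f x <= M * g x) -> same_order f g.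
Proof.
move=> m0 M0 g0 fg; split; apply/eqO_exP.
  exists M => //; apply: filterS2 g0 fg => x gx /andP[lo hi].
  rewrite [`|f x|]ger0_norm ?[`|g x|]ger0_norm//.
  by apply: le_trans lo; rewrite mulr_ge0// ltW.
exists m^-1; rewrite ?invr_gt0//; apply: filterS2 g0 fg => x gx /andP[lo hi].
have fx : 0 <= f x by apply: le_trans lo; rewrite mulr_ge0// ltW.
by rewrite [`|f x|]ger0_norm ?[`|g x|]ger0_norm// -ler_pdivrMl ?invr_gt0// invrK.
Qed.

Section eventually_equal.
Context {R : realType} (f f' g g' : R -> R).
Hypothesis fgE : \forall x \near +oo, f x = f' x /\ g x = g' x.

Lemma near_asymp_equiv : asymp_equiv f' g' -> asymp_equiv f g.
Proof.
apply: cvg_trans; apply: near_eq_cvg; apply: filterS fgE => x [-> ->].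
by [].
Qed.

Lemma near_same_order : same_order f' g' -> same_order f g.
Proof.
move=> [/eqO_exP[c c0 fg] /eqO_exP[c' c'0 gf]]; split; apply/eqO_exP.
  by exists c => //; apply: filterS2 fgE fg => x [-> ->].
by exists c' => //; apply: filterS2 fgE gf => x [-> ->].
Qed.

End eventually_equal.

(** * Closure of the classes under sums *)

Section sum_of_laws.
Context {R : realType}.
Variables V1 V2 V : set R -> \bar R.
Local Notation f := (tail V1).
Local Notation g := (tail V2).
Local Notation h := (tail V).
Hypotheses (f0 : forall x, 0 <= f x) (g0 : forall x, 0 <= g x).
Hypothesis h0 : forall x, 0 <= h x.
Hypotheses (f_ni : {homo f : x y /~ x <= y}) (g_ni : {homo g : x y /~ x <= y}).
Hypothesis h_ni : {homo h : x y /~ x <= y}.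
Hypotheses (fy : f x @[x --> +oo] --> (0 : R)) (gy : g x @[x --> +oo] --> (0 : R)).
Hypothesis fh : forall x, f x <= h x.
Hypothesis h_ge : forall x, 0 < x -> f x + g x - f x * g x <= h x.
Hypothesis h_half : forall x, h x <= f (x / 2) + g (x / 2).
Hypothesis h_le : forall k x, 0 < k -> 0 < x ->
  h x <= f (x - k) + g (x - k) + f k * g (x / 2) + g k * f (x / 2).

Let positive_tail_sum : positive_tail V1 -> positive_tail V.
Proof. by move=> V1_gt0 x x0; exact: lt_le_trans (V1_gt0 x x0) (fh x). Qed.

Let fg0 x : 0 <= (f \+ g) x. Proof. exact: addr_ge0. Qed.

Let fg_gt0 : positive_tail V1 -> \forall x \near +oo, 0 < (f \+ g) x.
Proof.
move=> V1_gt0; near=> x; rewrite /= ltr_wpDr//; apply: V1_gt0; near: x.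
by apply: nbhs_pinfty_ge; rewrite num_real.
Unshelve. all: by end_near. Qed.

Lemma sum_class_D : class_D V1 -> class_D V2 -> same_order h (f \+ g) /\ class_D V.
Proof.
move=> /class_DP[V1_gt0 fD] /class_DP[_ gD].
have [M M0 hM] := sum_tail_order f0 g0 fy h_ge h_half fD gD.
have half0 : 0 < (2^-1 : R) by lra.
split; first by apply: (bounds_same_order half0 M0 _ hM); exact: nearW.
apply/class_DP; split; first exact: positive_tail_sum.
exact: (dominated_transfer half0 (ltW M0) hM (dominatedD f0 g0 fD gD)).
Qed.

Lemma sum_class_DL : class_DL V1 -> class_DL V2 ->
  asymp_equiv h (f \+ g) /\ class_DL V.
Proof.
move=> [/class_DP[V1_gt0 fD] /(class_LP f_ni)[_ fL]].
move=> [/class_DP[_ gD] /(class_LP g_ni)[_ gL]].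
have hfg := sum_tail_equiv f0 g0 fy gy h_ge h_le fD gD fL gL.
have V_gt0 := positive_tail_sum V1_gt0.
split; first exact: tail_equiv_asymp_equiv (fg_gt0 V1_gt0) hfg.
split; first by apply/class_DP; split=> //;
  exact: tail_equiv_dominated hfg (dominatedD f0 g0 fD gD).
by apply/(class_LP h_ni); split=> //; exact: tail_equiv_long hfg (longD fL gL).
Qed.

Lemma sum_class_C : class_C V1 -> class_C V2 ->
  asymp_equiv h (f \+ g) /\ class_C V.
Proof.
move=> /(class_CP f_ni)[V1_gt0 fC] /(class_CP g_ni)[_ gC].
have hfg : tail_equiv h (f \+ g).
  apply: (sum_tail_equiv f0 g0 fy gy h_ge h_le).
  - exact: consistent_dominated fC.
  - exact: consistent_dominated gC.
  - exact: consistent_long fC.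
  - exact: consistent_long gC.
split; first exact: tail_equiv_asymp_equiv (fg_gt0 V1_gt0) hfg.
apply/(class_CP h_ni); split; first exact: positive_tail_sum.
exact: tail_equiv_consistent hfg (consistentD f_ni g_ni fC gC).
Qed.

Lemma sum_classes :
  [/\ (class_D V1 -> class_D V2 -> same_order h (f \+ g) /\ class_D V),
      (class_DL V1 -> class_DL V2 -> asymp_equiv h (f \+ g) /\ class_DL V) &
      (class_C V1 -> class_C V2 -> asymp_equiv h (f \+ g) /\ class_C V)].
Proof. by split; [exact: sum_class_D|exact: sum_class_DL|exact: sum_class_C]. Qed.

End sum_of_laws.

(** * The scale functional of a ruin set *)

Section scale_sup_theory.
Context {R : realType} {d : nat} (A : set 'rV[R]_d).
Implicit Types (x y : 'rV[R]_d) (s t u : R).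
Local Notation Y := (scale_sup A).

Lemma dilateE u x : 0 < u -> dilate u A x = A (u^-1 *: x).
Proof.
move=> u0; apply/propext; split => [[a Aa <-]|Ax].
  by rewrite scalerA mulVf ?gt_eqF// scale1r.
by exists (u^-1 *: x) => //; rewrite scalerA mulfV ?gt_eqF// scale1r.
Qed.

Lemma open_dilate u : 0 < u -> open A -> open (dilate u A).
Proof.
move=> u0 oA; rewrite (_ : dilate u A = *:%R u^-1 @^-1` A); last first.
  by apply/funext => x; rewrite dilateE.
by move/continuousP : (@scaler_continuous _ 'rV[R]_d u^-1); exact.
Qed.

(** For [t <= u], [x / t] is obtained from [x / u] by adding a nonnegative
    multiple of [x], which lies in the orthant. *)
Lemma dilate_le t u x : increasing_set A -> orthant x -> 0 < t -> t <= u ->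
  dilate u A x -> dilate t A x.
Proof.
move=> Ai x0 t0 tu; have u0 := lt_le_trans t0 tu; rewrite !dilateE// => Ax.
rewrite (_ : t^-1 *: x = u^-1 *: x + (t^-1 - u^-1) *: x); last first.
  by rewrite -scalerDl addrC subrK.
apply: Ai => // i; rewrite mxE mulr_ge0//.
by rewrite subr_ge0 lef_pV2.
Qed.

(** Since [x / u] tends to [0], it avoids [A] for large [u]: the supremum in
    [scale_sup] is a genuine one. *)
Lemma scale_set_ubound x : ~ closure A 0 ->
  has_ubound [set u | 0 < u /\ dilate u A x].
Proof.
move=> /existsNP[B] /not_implyP[B0 AB].
have /nbhs_ballP[e /= e0 eB] := B0.
exists (`|x| / e) => u [u0]; rewrite dilateE// => Ax.
rewrite leNgt; apply/negP => xu; apply: AB; exists (u^-1 *: x); split => //.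
apply: eB; rewrite -ball_normE /= sub0r normrN normrZ gtr0_norm ?invr_gt0//.
by rewrite ltr_pdivrMl// mulrC -ltr_pdivrMl// mulrC.
Qed.

Lemma scale_sup_ge0 x : ~ closure A 0 -> 0 <= Y x.
Proof.
move=> A0; have [[u Su]|/nonemptyPn S0] :=
    pselect ([set u | 0 < u /\ dilate u A x] !=set0).
  by apply: (le_trans (ltW Su.1)); exact: (ub_le_sup (scale_set_ubound x A0)).
by rewrite /scale_sup (_ : [set u | _] = set0) ?sup0//; apply/eqP/negPn/negP.
Qed.

Hypothesis A_ruin : ruin_set A.

Let A_open : open A. Proof. by case: A_ruin. Qed.
Let A_incr : increasing_set A. Proof. by case: A_ruin. Qed.
Let A_0 : ~ closure A 0. Proof. by case: A_ruin. Qed.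

(** Monotonicity in the scale gives the direct implication.  The inequality
    obtained in the converse is strict because [A] is open: if [x / t] is in
    [A], so is [v x] for some [v] slightly below [1 / t]. *)
Lemma scale_sup_gtP t x : orthant x -> 0 < t -> t < Y x <-> dilate t A x.
Proof.
move=> x0 t0; split => [tY|].
  have [[u Su]|S0] := pselect ([set u | 0 < u /\ dilate u A x] !=set0).
    have [||u' [u'0 Au'] tu'] := @sup_gt _ [set u | 0 < u /\ dilate u A x] t.
    - by exists u.
    - exact: tY.
    by apply: dilate_le Au' => //; exact: ltW.
  move: tY; rewrite /scale_sup (_ : [set u | _] = set0) ?sup0 ?ltNge ?(ltW t0)//.
  by apply/seteqP; split=> // u Su; case: S0; exists u.
rewrite dilateE// => Ax.
have [v [v0 vt Av]] : exists v, [/\ 0 < v, v < t^-1 & A (v *: x)].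
  have nA : \forall v \near t^-1, A (v *: x).
    by apply: (@scalel_continuous _ _ x t^-1); exact: open_nbhs_nbhs.
  near (t^-1)^'- => v; exists v; split; near: v.
  - by apply: nbhs_left_gt; rewrite invr_gt0.
  - exact: nbhs_left_lt.
  - exact: cvg_within nA.
have tv : t < v^-1 by rewrite -[t]invrK ltf_pV2 ?posrE ?invr_gt0.
apply: (lt_le_trans tv); apply: (ub_le_sup (scale_set_ubound x A_0)).
by split; rewrite ?invr_gt0// dilateE ?invr_gt0// invrK.
Unshelve. all: by end_near. Qed.

Lemma orthantD x y : orthant x -> orthant y -> orthant (x + y).
Proof. by move=> x0 y0 i; rewrite mxE addr_ge0. Qed.

Lemma scale_sup_le_add x y : orthant x -> orthant y -> Y x <= Y (x + y).
Proof.
move=> x0 y0; rewrite leNgt; apply/negP => Yxy.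
have Y0 := scale_sup_ge0 (x + y) A_0.
pose t := (Y (x + y) + Y x) / 2.
have t0 : 0 < t by rewrite /t; lra.
have /(scale_sup_gtP x0 t0) : t < Y x by rewrite /t; lra.
rewrite dilateE// => Ax.
have : t < Y (x + y).
  apply/(scale_sup_gtP (orthantD x0 y0) t0); rewrite dilateE// scalerDr.
  by apply: A_incr => // i; rewrite mxE mulr_ge0// invr_ge0 ltW.
rewrite /t; lra.
Qed.

(** If [s > Y x] and [t > Y y] then [x / s] and [y / t] avoid [A].  Their convex
    combination with weights [s / (s + t)] and [t / (s + t)] is
    [(x + y) / (s + t)], which avoids [A] as well, so that
    [Y (x + y) <= s + t]. *)
Lemma scale_sup_subadditive x y : orthant x -> orthant y ->
  Y (x + y) <= Y x + Y y.
Proof.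
move=> x0 y0; have Yx := scale_sup_ge0 x A_0; have Yy := scale_sup_ge0 y A_0.
apply/ler_addgt0Pr => e e0.
pose s := Y x + e / 2; pose t := Y y + e / 2.
have s0 : 0 < s by rewrite /s; lra.
have t0 : 0 < t by rewrite /t; lra.
have st0 : 0 < s + t by lra.
have nAx : ~ A (s^-1 *: x).
  by rewrite -dilateE// => /(scale_sup_gtP x0 s0); rewrite /s; lra.
have nAy : ~ A (t^-1 *: y).
  by rewrite -dilateE// => /(scale_sup_gtP y0 t0); rewrite /t; lra.
have -> : Y x + Y y + e = s + t by rewrite /s /t; lra.
rewrite leNgt; apply/negP => /(scale_sup_gtP (orthantD x0 y0) st0).
rewrite dilateE//.
have l0 : 0 <= s / (s + t) by rewrite divr_ge0 ?ltW.
have l1 : s / (s + t) <= 1 by rewrite ler_pdivrMr// mul1r lerDl ltW.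
have [_ _ _ cA _] := A_ruin.
have := cA (s^-1 *: x) (t^-1 *: y) (Itv01 l0 l1).
rewrite !inE => /(_ nAx nAy); apply: contra_not.
suff -> : (s + t)^-1 *: (x + y) = s / (s + t) *: (s^-1 *: x)
    + (1 - s / (s + t)) *: (t^-1 *: y) by [].
rewrite scalerDr !scalerA; congr (_ *: _ + _ *: _).
  by field; rewrite !gt_eqF.
by field; rewrite !gt_eqF.
Qed.

End scale_sup_theory.

(** * Tails of sums of independent variables *)

Section survival.
Context {disp : measure_display} {Omega : measurableType disp} {R : realType}.
Variable P : probability Omega R.
Implicit Types (Y : Omega -> R) (B C : set Omega) (x : R).

Definition survival Y x : R := fine (P [set w | x < Y w]).

Lemma prob_le B C : measurable B -> measurable C -> B `<=` C ->
  fine (P B) <= fine (P C).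
Proof.
move=> mB mC BC; apply: fine_le; rewrite ?fin_num_measure//.
by apply: le_measure; rewrite ?inE.
Qed.

Lemma prob_setU_le B C : measurable B -> measurable C ->
  fine (P (B `|` C)) <= fine (P B) + fine (P C).
Proof.
move=> mB mC; rewrite -fineD ?fin_num_measure//.
apply: fine_le; rewrite ?fin_numD ?fin_num_measure//; first exact: measurableU.
exact: measureU2.
Qed.

Lemma prob_setU B C : measurable B -> measurable C ->
  fine (P (B `|` C)) = fine (P B) + fine (P C) - fine (P (B `&` C)).
Proof.
move=> mB mC; have mBC := measurableI _ _ mB mC.
have mBC' := measurableU _ _ mB mC.
rewrite measureUfinl// ?ltey_eq ?fin_num_measure//.
by rewrite fineB ?fineD ?fin_numD ?fin_num_measure.
Qed.

Lemma survival_ge0 Y x : 0 <= survival Y x.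
Proof. by rewrite /survival fine_ge0. Qed.

Section measurable_function.
Variable Y : Omega -> R.
Hypothesis mY : measurable_fun setT Y.

Lemma measurable_gt x : measurable [set w | x < Y w].
Proof.
rewrite (_ : [set w | _] = setT `&` Y @^-1` `]x, +oo[).
  by apply: mY => //; exact: measurable_itv.
by rewrite setTI; apply/seteqP; split => w /=; rewrite in_itv/= andbT.
Qed.

Lemma survival_nonincreasing : {homo survival Y : x y /~ x <= y}.
Proof.
move=> y x yx; apply: prob_le; [exact: measurable_gt..|].
by move=> w /=; exact: le_lt_trans.
Qed.

Lemma survival_cvg0 : survival Y x @[x --> +oo] --> (0 : R).
Proof.
pose Y' : {RV P >-> R} := mfun_Sub (mem_set mY).
have /fine_cvgP[_] := cvg_ccdfy0 Y'.
apply: cvg_trans; apply: near_eq_cvg; apply: nearW => x.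
rewrite /= /ccdf /distribution /pushforward /survival; congr (fine (P _)).
by apply/seteqP; split => w /=; rewrite in_itv/= andbT.
Qed.

End measurable_function.

(** For [scale_sup], only the rays with a positive endpoint have an explicit
    preimage; the ray from [0] is a countable union of those. *)
Lemma measurable_fun_positive_rays Y : (forall w, 0 <= Y w) ->
  (forall x, 0 < x -> measurable [set w | x < Y w]) -> measurable_fun setT Y.
Proof.
move=> Y0 mY; apply: (measurability _ (RGenOInfty.measurableE R)).
move=> _ [_ [x ->] <-]; rewrite setTI.
rewrite (_ : _ @^-1` _ = [set w | x < Y w]); last first.
  by apply/seteqP; split => w /=; rewrite in_itv/= andbT.
have [x0|x0|<-] := ltgtP 0 x.
- exact: mY.
- rewrite (_ : [set w | _] = setT)//; apply/seteqP; split=> // w _ /=.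
  exact: lt_le_trans x0 (Y0 w).
- rewrite (_ : [set w | _] = \bigcup_n [set w | n.+1%:R^-1 < Y w]).
    by apply: bigcupT_measurable => n; apply: mY; rewrite invr_gt0.
  apply/seteqP; split => [w /= Yw|w [n _]/=]; last first.
    by apply: lt_trans; rewrite invr_gt0.
  have [n] := ltr_add_invr Yw.
  by rewrite add0r => ?; exists n.
Qed.

(** Independence is assumed on rays with positive endpoints, whose preimages
    under [scale_sup A] are dilates of [A]. *)
Section independent_sum.
Variables Y1 Y2 Z : Omega -> R.
Hypotheses (mY1 : measurable_fun setT Y1) (mY2 : measurable_fun setT Y2).
Hypothesis mZ : measurable_fun setT Z.
Hypothesis Y12_indep : forall x y, 0 < x -> 0 < y ->
  fine (P ([set w | x < Y1 w] `&` [set w | y < Y2 w])) =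
  survival Y1 x * survival Y2 y.
Hypotheses (Y1Z : forall w, Y1 w <= Z w) (Y2Z : forall w, Y2 w <= Z w).
Hypothesis ZY : forall w, Z w <= Y1 w + Y2 w.

Let mgt1 x := measurable_gt mY1 x.
Let mgt2 x := measurable_gt mY2 x.
Let mgtZ x := measurable_gt mZ x.

Lemma survival_sum_ge x : 0 < x ->
  survival Y1 x + survival Y2 x - survival Y1 x * survival Y2 x <= survival Z x.
Proof.
move=> x0; rewrite -Y12_indep// -prob_setU//.
apply: prob_le => //; first exact: measurableU.
by move=> w [] /= /lt_le_trans; apply.
Qed.

Lemma survival_sum_half x :
  survival Z x <= survival Y1 (x / 2) + survival Y2 (x / 2).
Proof.
apply: le_trans (prob_setU_le (mgt1 _) (mgt2 _)).
apply: prob_le => //; first exact: measurableU.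
move=> w /= xZ; have [Y1x|] := ltP (x / 2) (Y1 w); first by left.
by move=> Y1x; right => /=; have := ZY w; lra.
Qed.

(** If [Y1 <= x - k], [Y2 <= x - k] and [Y1 + Y2 > x], then both exceed [k], and
    at least one of them exceeds [x / 2]. *)
Lemma survival_sum_le k x : 0 < k -> 0 < x ->
  survival Z x <= survival Y1 (x - k) + survival Y2 (x - k)
    + survival Y1 k * survival Y2 (x / 2) + survival Y2 k * survival Y1 (x / 2).
Proof.
move=> k0 x0; have x2 : 0 < x / 2 by lra.
rewrite -Y12_indep// [survival Y2 k * _]mulrC -Y12_indep//.
have mI y z := measurableI _ _ (mgt1 y) (mgt2 z).
have mU := measurableU _ _ (mgt1 (x - k)) (mgt2 (x - k)).
have mU3 := measurableU _ _ mU (mI k (x / 2)).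
apply: le_trans (lerD (lerD (prob_setU_le (mgt1 _) (mgt2 _)) (lexx _)) (lexx _)).
apply: le_trans (lerD (prob_setU_le mU (mI _ _)) (lexx _)).
apply: le_trans (prob_setU_le mU3 (mI _ _)).
apply: prob_le => //; first exact: measurableU.
move=> w /= xZ; have ZYw := ZY w.
have [Y1x|Y1x] := ltP (x - k) (Y1 w); first by left; left; left.
have [Y2x|Y2x] := ltP (x - k) (Y2 w); first by left; left; right.
have [Y2x2|Y2x2] := ltP (x / 2) (Y2 w).
  by left; right; split => //=; lra.
by right; split => /=; lra.
Qed.

End independent_sum.
End survival.

(** * The scale functional of a random vector *)

Lemma tail_scale_law (R : realType) (d : nat) (A : set 'rV[R]_d)
    (disp : measure_display) (Omega : measurableType disp)
    (P : probability Omega R) (X : {RV P >-> borel_rV R d}) :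
  tail (scale_law A (distribution P X)) = survival P (scale_sup A \o X).
Proof.
apply/funext => x; rewrite /tail /scale_law /distribution /pushforward /survival.
by congr (fine (P _)); apply/seteqP; split => w /=; rewrite in_itv/= andbT.
Qed.

Section scale_of_random_vector.
Context {R : realType} {d : nat} {disp : measure_display}
  {Omega : measurableType disp} {A : set 'rV[R]_d}.
Variable X : {mfun Omega >-> borel_rV R d}.
Hypotheses (A_ruin : ruin_set A) (X_ge0 : forall w, orthant (X w : 'rV[R]_d)).

Lemma measurable_dilate u : 0 < u -> measurable (dilate u A : set (borel_rV R d)).
Proof.
move=> u0; apply: sub_sigma_algebra; apply: open_dilate => //.
by case: A_ruin.
Qed.

Lemma preimage_dilate u : 0 < u ->
  [set w | u < scale_sup A (X w)] = X @^-1` (dilate u A).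
Proof.
move=> u0; apply/seteqP.
by split => w /= /(scale_sup_gtP A_ruin (X_ge0 w) u0).
Qed.

Lemma measurable_scale_sup : measurable_fun setT (scale_sup A \o X).
Proof.
apply: measurable_fun_positive_rays => [w|u u0] /=.
  by apply: scale_sup_ge0; case: A_ruin.
rewrite preimage_dilate// -[X in measurable X]setTI.
exact: (measurable_funPT X measurableT _ (measurable_dilate u0)).
Qed.

Lemma distribution_dilate (P : probability Omega R) u : 0 < u ->
  fine (distribution P X (dilate u A)) = survival P (scale_sup A \o X) u.
Proof. by move=> u0; rewrite /survival /= preimage_dilate. Qed.

End scale_of_random_vector.

(** * Sums of independent random vectors *)

Theorem theorem3p3 (R : realType) (d : nat) (d_ge1 : (1 <= d)%N)
    (A : set 'rV[R]_d) (A_ruin : ruin_set A)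
    (disp : measure_display) (Omega : measurableType disp)
    (P : probability Omega R) (X1 X2 : {RV P >-> borel_rV R d})
    (X1_ge0 : forall w, orthant (X1 w : 'rV[R]_d))
    (X2_ge0 : forall w, orthant (X2 w : 'rV[R]_d))
    (X12_indep : independent_rv X1 X2) :
  let F1 : set 'rV[R]_d -> \bar R := distribution P X1 in
  let F2 : set 'rV[R]_d -> \bar R := distribution P X2 in
  let F12 : set 'rV[R]_d -> \bar R := distribution P (sum_rv X1 X2) in
  let f12 : R -> R := fun x => fine (F12 (dilate x A)) in
  let f1_plus_f2 : R -> R :=
    fun x => fine (F1 (dilate x A)) + fine (F2 (dilate x A)) in
  [/\ (class_D (scale_law A F1) -> class_D (scale_law A F2) ->
        same_order f12 f1_plus_f2 /\ class_D (scale_law A F12)),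
      (class_DL (scale_law A F1) -> class_DL (scale_law A F2) ->
        asymp_equiv f12 f1_plus_f2 /\ class_DL (scale_law A F12)) &
      (class_C (scale_law A F1) -> class_C (scale_law A F2) ->
        asymp_equiv f12 f1_plus_f2 /\ class_C (scale_law A F12))].
Proof.
move=> F1 F2 F12 f12 f1_plus_f2.
have X12_ge0 w : orthant (sum_rv X1 X2 w : 'rV[R]_d) by exact: orthantD.
pose Y1 := scale_sup A \o (X1 : Omega -> 'rV[R]_d).
pose Y2 := scale_sup A \o (X2 : Omega -> 'rV[R]_d).
pose Y12 := scale_sup A \o (sum_rv X1 X2 : Omega -> 'rV[R]_d).
have mY1 : measurable_fun setT Y1 := measurable_scale_sup A_ruin X1_ge0.
have mY2 : measurable_fun setT Y2 := measurable_scale_sup A_ruin X2_ge0.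
have mY12 : measurable_fun setT Y12 := measurable_scale_sup A_ruin X12_ge0.
have Y12_indep x y : 0 < x -> 0 < y ->
    fine (P ([set w | x < Y1 w] `&` [set w | y < Y2 w])) =
    survival P Y1 x * survival P Y2 y.
  move=> x0 y0; rewrite /survival /Y1 /Y2 /=.
  rewrite (preimage_dilate A_ruin X1_ge0)// (preimage_dilate A_ruin X2_ge0)//.
  have mx : measurable (dilate x A : set (borel_rV R d)) by exact: measurable_dilate.
  have my : measurable (dilate y A : set (borel_rV R d)) by exact: measurable_dilate.
  rewrite (X12_indep _ _ mx my) fineM//; apply: fin_num_measure;
    rewrite -[X in measurable X]setTI; exact: measurable_funPT.
have Y1_le w : Y1 w <= Y12 w by exact: scale_sup_le_add.
have Y2_le w : Y2 w <= Y12 w.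
  by rewrite /Y12 /= /sum_rv addrC; exact: scale_sup_le_add.
have Y12_le w : Y12 w <= Y1 w + Y2 w by exact: scale_sup_subadditive.
have E1 : tail (scale_law A F1) = survival P Y1 := tail_scale_law A X1.
have E2 : tail (scale_law A F2) = survival P Y2 := tail_scale_law A X2.
have E12 : tail (scale_law A F12) = survival P Y12 :=
  tail_scale_law A (sum_rv X1 X2).
have fE : \forall x \near +oo, f12 x = tail (scale_law A F12) x /\
    f1_plus_f2 x = (tail (scale_law A F1) \+ tail (scale_law A F2)) x.
  near=> x; have x0 : 0 < x by near: x; apply: nbhs_pinfty_gt; rewrite num_real.
  by rewrite E1 E2 E12 /f12 /f1_plus_f2 /F1 /F2 /F12 !distribution_dilate.
have s_ge0 := @survival_ge0 _ Omega _ P.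
have s_ni := @survival_nonincreasing _ Omega _ P.
have s_y := @survival_cvg0 _ Omega _ P.
have s12_ge := survival_sum_ge mY1 mY2 mY12 Y12_indep Y1_le Y2_le.
have s12_half := survival_sum_half P mY1 mY2 mY12 Y12_le.
have s12_le := survival_sum_le mY1 mY2 mY12 Y12_indep Y12_le.
have s1_le x : survival P Y1 x <= survival P Y12 x.
  by apply: prob_le => [||w /= /lt_le_trans]; [exact: measurable_gt..|apply].
have [||||||||||||sD sDL sC] :=
    @sum_classes R (scale_law A F1) (scale_law A F2) (scale_law A F12);
  rewrite ?E1 ?E2 ?E12; [by auto.. | ].
split=> B1 B2.
- by have [] := sD B1 B2; move=> /(near_same_order fE).
- by have [] := sDL B1 B2; move=> /(near_asymp_equiv fE).
- by have [] := sC B1 B2; move=> /(near_asymp_equiv fE).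
Unshelve. all: by end_near. Qed.
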